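(* Let $M=0$, $\delta_2\in(-8,0)$ and $\delta_1\in\mathbb{R}$. Then $G_{0,\delta_1,\delta_2}(t,s)>0$ for all $(t,s)\in[0,1]\times[0,1]$ if and only if $$|\delta_1|<\begin{cases}\frac12\sqrt{-8\delta_2-\delta_2^{2}}, & \delta_2\in(-8,-4),\\ 2, & \delta_2\in[-4,0).\end{cases}$$
   Context: Let $I=[0,1]$. For real parameters $M,\delta_1,\delta_2$ consider the problem $$u''(t)+M\,u(t)=\sigma(t),\ t\in I,\qquad u(0)-u(1)=\delta_1\int_0^1u(s)\,ds,\qquad u'(0)-u'(1)=\delta_2\int_0^1u(s)\,ds,$$ with $\sigma\in C(I)$. If this problem has a unique solution $u\in C^2(I)$ for every $\sigma\in C(I)$ (this happens exactly when $\delta_2\ne M$ and $M\neq 4k^2\pi^2$ for all integers $k\ge 1$), its Green's function $G_{M,\delta_1,\delta_2}$ is the unique continuous function on $I\times I$ such that for every $\sigma\in C(I)$ the unique solution is $u(t)=\int_0^1G_{M,\delta_1,\delta_2}(t,s)\,\sigma(s)\,ds$. Here $M=0$. *)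

(* Defs.v *)
From Stdlib Require Import Reals.
From Coquelicot Require Import Coquelicot.
Open Scope R_scope.

(* Functions on [0,1] and [0,1]^2 are represented by total functions on R and
   R * R of which only the values on these sets matter: continuity and
   derivatives are relative to the set, hence one-sided at the end points. *)

Definition unit_interval (t : R) : Prop := 0 <= t <= 1.

Definition unit_square (p : R * R) : Prop :=
  unit_interval (fst p) /\ unit_interval (snd p).

Definition C2_with_derivatives (u u' u'' : R -> R) : Prop :=
  (forall t, unit_interval t -> D_in u u' unit_interval t) /\
  (forall t, unit_interval t -> D_in u' u'' unit_interval t) /\
  continuous_on unit_interval u''.

Definition is_solution (M delta1 delta2 : R) (sigma u : R -> R) : Prop :=
  exists u' u'' : R -> R,
    C2_with_derivatives u u' u'' /\
    (forall t, unit_interval t -> u'' t + M * u t = sigma t) /\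
    u 0 - u 1 = delta1 * RInt u 0 1 /\
    u' 0 - u' 1 = delta2 * RInt u 0 1.

Definition is_green_function (M delta1 delta2 : R) (G : R -> R -> R) : Prop :=
  continuous_on unit_square (fun p : R * R => G (fst p) (snd p)) /\
  forall sigma : R -> R, continuous_on unit_interval sigma ->
    is_solution M delta1 delta2 sigma
      (fun t => RInt (fun s => G t s * sigma s) 0 1) /\
    (forall u : R -> R, is_solution M delta1 delta2 sigma u ->
       forall t, unit_interval t ->
         u t = RInt (fun s => G t s * sigma s) 0 1).

(* Main.v *)
Require Import Defs.
From Stdlib Require Import Reals Lra Psatz.
From Coquelicot Require Import Coquelicot.
Open Scope R_scope.

(** Integrating [u'' = sigma] twice and solving for the two constants gives the
    Green's function in closed form,
    [-/d2 + (d1/d2) (t - 1/2) - t (1 - t) / 2 + h (1 - h) / 2] with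
    [h = |t - s|] ([green_kernel]).  Written this way, [s] enters only through
    [h], and the term [h (1 - h) / 2] is nonnegative on the square and vanishes
    on the diagonal.  Positivity on the square is therefore positivity of the
    diagonal, a quadratic polynomial in [t] ([green_kernel_pos_iff]).  That
    quadratic is convex because [d2 < 0]: it is positive at the end points iff
    [|d1| < 2], and its vertex is interior exactly when [|d1| < - d2 / 2], which
    brings in the discriminant.  For [d2 < -4] the discriminant bound is the
    smaller of the two and governs; for [d2 >= -4] the end points govern
    ([diagonal_pos_iff]).

    A Green's function is only given through the integrals it produces, so it has
    to be identified with the closed form pointwise ([green_function_unique]).
    The integral of the closed form against a continuous [sigma] solves the
    problem, hence it agrees with the integral of [G t] against [sigma].
    Taking for [sigma] the difference of the two kernels at a fixed [t], the
    integral of the square of that difference is zero, and the difference is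
    continuous. *)

(** * Restriction to the unit interval and the unit square *)

Lemma is_derive_D_in (f df : R -> R) (D : R -> Prop) (x : R) :
  is_derive f x (df x) -> D_in f df D x.
Proof.
  intros H. apply D_in_imp with no_cond.
  - intros; exact I.
  - now apply derivable_pt_lim_D_in, is_derive_Reals.
Qed.

Lemma continuous_continuous_on (D : R -> Prop) (f : R -> R) :
  (forall x, continuous f x) -> continuous_on D f.
Proof.
  intros H x _. apply filterlim_filter_le_1 with (2 := H x).
  apply filter_le_within.
Qed.

(** Nearest-point retraction onto the unit interval: composing with it extends a
    function that is continuous on the interval only to a continuous function
    on the line. *)
Definition clamp (s : R) : R := Rmax 0 (Rmin 1 s).

Lemma clamp_unit (s : R) : unit_interval (clamp s).
Proof.
  unfold unit_interval, clamp, Rmax, Rmin.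
  repeat destruct Rle_dec; lra.
Qed.

Lemma clamp_id (s : R) : unit_interval s -> clamp s = s.
Proof.
  unfold unit_interval, clamp, Rmax, Rmin.
  repeat destruct Rle_dec; lra.
Qed.

Lemma clamp_continuous (s : R) : continuous clamp s.
Proof.
  apply filterlim_locally. intros eps. exists eps. intros y Hy.
  apply Rle_lt_trans with (2 := Hy).
  change (Rabs (clamp y - clamp s) <= Rabs (y - s)).
  unfold clamp, Rmax, Rmin; repeat destruct Rle_dec;
    unfold Rabs; repeat destruct Rcase_abs; lra.
Qed.

Lemma continuous_section_clamp (G : R -> R -> R) (t : R) :
  continuous_on unit_square (fun p : R * R => G (fst p) (snd p)) ->
  unit_interval t ->
  forall s, continuous (fun s => G t (clamp s)) s.
Proof.
  intros HG Ht s.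
  assert (Hp : unit_square (t, clamp s)) by (split; [exact Ht | apply clamp_unit]).
  refine (filterlim_comp _ _ _ (fun s => (t, clamp s))
            (fun p : R * R => G (fst p) (snd p)) _ _ _ _ (HG _ Hp)).
  assert (Hc : continuous (fun s => (t, clamp s)) s).
  { apply filterlim_locally. intros eps.
    assert (Hb := proj1 (filterlim_locally clamp (clamp s)) (clamp_continuous s) eps).
    revert Hb. apply filter_imp. intros y Hy. split; [apply ball_center | exact Hy]. }
  intros P HP. unfold within in HP.
  apply Hc in HP. unfold filtermap in *.
  revert HP. apply filter_imp. intros y Hy. apply Hy.
  split; [exact Ht | apply clamp_unit].
Qed.

(** * A continuous function whose square has zero integral *)

Lemma RInt_square_eq_0 (f : R -> R) (a b : R) :
  a < b -> (forall x, continuous f x) ->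
  RInt (fun s => f s * f s) a b = 0 ->
  forall x, a <= x <= b -> f x = 0.
Proof.
  intros Hab Hf H0 x Hx.
  assert (Hc : forall y, continuous (fun s => f s * f s) y).
  { intros y. apply (continuous_mult (K := R_AbsRing) f f); apply Hf. }
  assert (Hi : forall c d, ex_RInt (fun s => f s * f s) c d).
  { intros c d. apply (ex_RInt_continuous (V := R_CompleteNormedModule)).
    intros; apply Hc. }
  destruct (Req_dec (f x) 0) as [|Hne]; [assumption | exfalso].
  assert (Hpos : 0 < Rabs (f x)) by now apply Rabs_pos_lt.
  destruct (proj1 (filterlim_locally f (f x)) (Hf x) (mkposreal _ Hpos))
    as [del Hdel].
  assert (Hdel0 := cond_pos del).
  set (c := Rmax a (x - del / 2)). set (d := Rmin b (x + del / 2)).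
  assert (Hcd : c < d /\ a <= c /\ d <= b /\ x - del < c /\ d < x + del).
  { unfold c, d, Rmax, Rmin; repeat destruct Rle_dec; lra. }
  assert (H1 : 0 <= RInt (fun s => f s * f s) a c).
  { apply RInt_ge_0; [lra | apply Hi | intros; nra]. }
  assert (H3 : 0 <= RInt (fun s => f s * f s) d b).
  { apply RInt_ge_0; [lra | apply Hi | intros; nra]. }
  assert (H2 : 0 < RInt (fun s => f s * f s) c d).
  { apply RInt_gt_0; [lra | | intros; apply Hc].
    intros y Hy.
    assert (Hb : Rabs (f y - f x) < Rabs (f x)).
    { apply (Hdel y). change (Rabs (y - x) < del). apply Rabs_def1; lra. }
    assert (f y <> 0); [|nra].
    intros E. rewrite E, Rminus_0_l, Rabs_Ropp in Hb. lra. }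
  assert (E1 := RInt_Chasles (fun s => f s * f s) a c d (Hi _ _) (Hi _ _)).
  assert (E2 := RInt_Chasles (fun s => f s * f s) a d b (Hi _ _) (Hi _ _)).
  unfold plus in E1, E2; simpl in E1, E2. lra.
Qed.

(** * The solution in terms of moments of the right-hand side *)

Definition moment (sigma : R -> R) (k : nat) (t : R) : R :=
  RInt (fun s => s ^ k * sigma s) 0 t.

Lemma moment_0 (sigma : R -> R) (k : nat) : moment sigma k 0 = 0.
Proof. exact (RInt_point 0 _). Qed.

Lemma continuous_pow_mult (sigma : R -> R) (k : nat) :
  (forall x, continuous sigma x) ->
  forall x, continuous (fun s => s ^ k * sigma s) x.
Proof.
  intros Hs x. apply (continuous_mult (K := R_AbsRing) (fun s => s ^ k) sigma).
  - apply (ex_derive_continuous (V := R_NormedModule)). auto_derive; exact I.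
  - apply Hs.
Qed.

Lemma is_derive_moment (sigma : R -> R) (k : nat) (t : R) :
  (forall x, continuous sigma x) ->
  is_derive (moment sigma k) t (t ^ k * sigma t).
Proof.
  intros Hs.
  apply (is_derive_RInt (fun s => s ^ k * sigma s) (moment sigma k) 0 t).
  - apply filter_forall. intros b. apply (RInt_correct (V := R_CompleteNormedModule)).
    apply (ex_RInt_continuous (V := R_CompleteNormedModule)).
    intros z _. now apply continuous_pow_mult.
  - now apply continuous_pow_mult.
Qed.

Lemma is_RInt_quadratic_mult (sigma : R -> R) (a b c x y : R) :
  (forall z, continuous sigma z) ->
  is_RInt (fun s => (a + b * s + c * s ^ 2) * sigma s) x y
    (a * (moment sigma 0 y - moment sigma 0 x)
     + b * (moment sigma 1 y - moment sigma 1 x)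
     + c * (moment sigma 2 y - moment sigma 2 x)).
Proof.
  intros Hs.
  evar_last.
  - apply (is_RInt_derive (V := R_CompleteNormedModule)
      (fun s => a * moment sigma 0 s + b * moment sigma 1 s + c * moment sigma 2 s)).
    + intros z _.
      assert (H0 := is_derive_moment sigma 0 z Hs).
      assert (H1 := is_derive_moment sigma 1 z Hs).
      assert (H2 := is_derive_moment sigma 2 z Hs).
      auto_derive.
      * repeat split; eexists; eassumption.
      * replace (Derive (fun x : R => moment sigma 0 x) z) with (z ^ 0 * sigma z)
          by (symmetry; exact (is_derive_unique _ _ _ H0)).
        replace (Derive (fun x : R => moment sigma 1 x) z) with (z ^ 1 * sigma z)
          by (symmetry; exact (is_derive_unique _ _ _ H1)).
        replace (Derive (fun x : R => moment sigma 2 x) z) with (z ^ 2 * sigma z)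
          by (symmetry; exact (is_derive_unique _ _ _ H2)).
        ring.
    + intros z _.
      apply (continuous_mult (K := R_AbsRing) (fun s => a + b * s + c * s ^ 2) sigma).
      * apply (ex_derive_continuous (V := R_NormedModule)). auto_derive; exact I.
      * apply Hs.
  - unfold minus, plus, opp; simpl. ring.
Qed.

(** Every solution of [u'' = sigma] is [A + B t] plus the integral of
    [(t - s) sigma(s)] over [s] in [[0, t]], that is [t m0(t) - m1(t)] in terms of
    the moments.  The condition on [u'] forces the
    mean of [u] to be [- m0(1) / d2]; the condition on [u] then gives [B], and
    the value of the mean gives [A]. *)
Definition solution (d1 d2 : R) (sigma : R -> R) (t : R) : R :=
  (- / d2 * moment sigma 0 1 - d1 / (2 * d2) * moment sigma 0 1
   + (moment sigma 0 1 - moment sigma 1 1) / 2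
   - (moment sigma 0 1 - 2 * moment sigma 1 1 + moment sigma 2 1) / 2)
  + (d1 / d2 * moment sigma 0 1 - (moment sigma 0 1 - moment sigma 1 1)) * t
  + t * moment sigma 0 t - moment sigma 1 t.

Lemma solution_is_solution (d1 d2 : R) (sigma : R -> R) :
  d2 <> 0 -> (forall x, continuous sigma x) ->
  is_solution 0 d1 d2 sigma (solution d1 d2 sigma).
Proof.
  intros Hd Hs.
  assert (D0 := fun t => is_derive_moment sigma 0 t Hs).
  assert (D1 := fun t => is_derive_moment sigma 1 t Hs).
  assert (D2 := fun t => is_derive_moment sigma 2 t Hs).
  assert (V0 : forall t, Derive (fun x : R => moment sigma 0 x) t = t ^ 0 * sigma t)
    by (intros; apply is_derive_unique, D0).
  assert (V1 : forall t, Derive (fun x : R => moment sigma 1 x) t = t ^ 1 * sigma t)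
    by (intros; apply is_derive_unique, D1).
  assert (V2 : forall t, Derive (fun x : R => moment sigma 2 x) t = t ^ 2 * sigma t)
    by (intros; apply is_derive_unique, D2).
  set (B := d1 / d2 * moment sigma 0 1 - (moment sigma 0 1 - moment sigma 1 1)).
  assert (Du : forall t, is_derive (solution d1 d2 sigma) t (B + moment sigma 0 t)).
  { intros t. unfold solution. fold B. auto_derive.
    - repeat split; eexists; eauto.
    - rewrite V0, V1. ring. }
  assert (Du' : forall t, is_derive (fun t => B + moment sigma 0 t) t (sigma t)).
  { intros t. auto_derive.
    - repeat split; eexists; eauto.
    - rewrite V0. ring. }
  assert (HI : RInt (solution d1 d2 sigma) 0 1 = - moment sigma 0 1 / d2).
  { apply is_RInt_unique.
    evar_last.
    - apply (is_RInt_derive (V := R_CompleteNormedModule)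
        (fun t => solution d1 d2 sigma 0 * t + B * t ^ 2 / 2
           + t ^ 2 / 2 * moment sigma 0 t - t * moment sigma 1 t
           + moment sigma 2 t / 2)).
      + intros t _. auto_derive.
        * repeat split; eexists; eauto.
        * rewrite V0, V1, V2. unfold solution. fold B.
          rewrite !moment_0. field. exact Hd.
      + intros t _. apply (ex_derive_continuous (V := R_NormedModule)).
        eexists; apply Du.
    - unfold minus, plus, opp; simpl. unfold solution, B.
      rewrite !moment_0. field. exact Hd. }
  exists (fun t => B + moment sigma 0 t), sigma.
  split; [split; [|split]|split; [|split]].
  - intros t _. now apply is_derive_D_in.
  - intros t _. now apply is_derive_D_in.
  - now apply continuous_continuous_on.
  - intros t _. ring.
  - rewrite HI. unfold solution. rewrite !moment_0. field. exact Hd.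
  - rewrite HI, moment_0. field. exact Hd.
Qed.

(** * The Green's function in closed form *)

Definition green_kernel (d1 d2 t s : R) : R :=
  - / d2 + d1 / d2 * (t - 1 / 2) - t * (1 - t) / 2
  + Rabs (t - s) * (1 - Rabs (t - s)) / 2.

Lemma green_kernel_continuous (d1 d2 t : R) :
  forall s, continuous (green_kernel d1 d2 t) s.
Proof.
  intros s. unfold green_kernel.
  assert (Ha : continuous (fun s => Rabs (t - s)) s).
  { apply (continuous_Rabs_comp (fun s => t - s)).
    apply (ex_derive_continuous (V := R_NormedModule)). auto_derive; exact I. }
  apply (continuous_comp (fun s => Rabs (t - s))
    (fun h => - / d2 + d1 / d2 * (t - 1 / 2) - t * (1 - t) / 2 + h * (1 - h) / 2)).
  - exact Ha.
  - apply (ex_derive_continuous (V := R_NormedModule)). auto_derive; exact I.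
Qed.

Lemma is_RInt_green_kernel (d1 d2 : R) (sigma : R -> R) (t : R) :
  d2 <> 0 -> (forall x, continuous sigma x) -> unit_interval t ->
  is_RInt (fun s => green_kernel d1 d2 t s * sigma s) 0 1
    (solution d1 d2 sigma t).
Proof.
  intros Hd Hs [Ht0 Ht1].
  set (c := - / d2 + d1 / d2 * (t - 1 / 2) - t * (1 - t) / 2).
  (* On each side of [t] the kernel is a quadratic polynomial in [s]. *)
  evar_last.
  - apply (is_RInt_Chasles (V := R_NormedModule) _ 0 t 1).
    + eapply is_RInt_ext.
      2: exact (is_RInt_quadratic_mult sigma
                  (c + t / 2 - t ^ 2 / 2) (t - 1 / 2) (- (1 / 2)) 0 t Hs).
      intros s. rewrite Rmin_left, Rmax_right by lra. intros Hst.
      unfold green_kernel. fold c. rewrite Rabs_pos_eq by lra. simpl. field.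
    + eapply is_RInt_ext.
      2: exact (is_RInt_quadratic_mult sigma
                  (c - t / 2 - t ^ 2 / 2) (t + 1 / 2) (- (1 / 2)) t 1 Hs).
      intros s. rewrite Rmin_left, Rmax_right by lra. intros Hst.
      unfold green_kernel. fold c. rewrite Rabs_left by lra. simpl. field.
  - unfold plus; simpl. unfold solution, c. rewrite !moment_0. field. exact Hd.
Qed.

Lemma green_function_unique (d1 d2 : R) (G : R -> R -> R) :
  d2 <> 0 -> is_green_function 0 d1 d2 G ->
  forall t s, unit_interval t -> unit_interval s ->
    G t s = green_kernel d1 d2 t s.
Proof.
  intros Hd [HGc HG] t s Ht Hs.
  set (g := fun s => G t (clamp s)).
  set (k := green_kernel d1 d2 t).
  assert (Cg : forall x, continuous g x) by now apply continuous_section_clamp.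
  assert (Ck : forall x, continuous k x) by apply green_kernel_continuous.
  set (sigma := fun s => g s - k s).
  assert (Cs : forall x, continuous sigma x).
  { intros x. apply (continuous_minus (V := R_NormedModule) g k); auto. }
  assert (Hprod : forall f : R -> R, (forall x, continuous f x) ->
            ex_RInt (fun s => f s * sigma s) 0 1).
  { intros f Cf. apply (ex_RInt_continuous (V := R_CompleteNormedModule)).
    intros z _. now apply (continuous_mult (K := R_AbsRing) f sigma). }
  assert (Hgk : RInt (fun s => g s * sigma s) 0 1 = RInt (fun s => k s * sigma s) 0 1).
  { transitivity (solution d1 d2 sigma t).
    2: { symmetry. apply is_RInt_unique. now apply is_RInt_green_kernel. }
    rewrite (proj2 (HG sigma (continuous_continuous_on _ _ Cs)) _
               (solution_is_solution d1 d2 sigma Hd Cs) t Ht).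
    apply RInt_ext. intros x. rewrite Rmin_left, Rmax_right by lra. intros Hx.
    unfold g. rewrite clamp_id; [reflexivity | unfold unit_interval; lra]. }
  assert (H0 : RInt (fun s => sigma s * sigma s) 0 1 = 0).
  { rewrite (RInt_ext _ (fun s => minus (g s * sigma s) (k s * sigma s))).
    - rewrite (RInt_minus (V := R_CompleteNormedModule)) by now apply Hprod.
      rewrite Hgk. unfold minus, plus, opp; simpl. ring.
    - intros x _. unfold minus, plus, opp, sigma; simpl. ring. }
  assert (E := RInt_square_eq_0 sigma 0 1 Rlt_0_1 Cs H0 s Hs).
  unfold sigma, g in E. rewrite clamp_id in E by exact Hs.
  exact (Rminus_diag_uniq _ _ E).
Qed.

(** * Positivity *)

(** The diagonal value, multiplied by [- d2] and written in the centred variable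
    [x = t - 1/2]. *)
Definition diagonal (d1 d2 x : R) : R := 1 - d1 * x + d2 / 8 - d2 * x ^ 2 / 2.

Lemma green_kernel_pos_iff (d1 d2 : R) :
  d2 < 0 ->
  (forall t s, 0 <= t <= 1 -> 0 <= s <= 1 -> 0 < green_kernel d1 d2 t s) <->
  (forall x, - (1 / 2) <= x <= 1 / 2 -> 0 < diagonal d1 d2 x).
Proof.
  intros Hd.
  assert (E : forall t s, - d2 * green_kernel d1 d2 t s =
    diagonal d1 d2 (t - 1 / 2) + - d2 * (Rabs (t - s) * (1 - Rabs (t - s)) / 2)).
  { intros t s. unfold green_kernel, diagonal. field. lra. }
  split.
  - intros H x Hx.
    specialize (H (x + 1 / 2) (x + 1 / 2)).
    specialize (E (x + 1 / 2) (x + 1 / 2)).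
    rewrite Rminus_diag, Rabs_R0 in E.
    replace (x + 1 / 2 - 1 / 2) with x in E by ring.
    assert (0 < green_kernel d1 d2 (x + 1 / 2) (x + 1 / 2)) by (apply H; lra).
    nra.
  - intros H t s Ht Hs.
    specialize (H (t - 1 / 2)). specialize (E t s).
    assert (Hh : 0 <= Rabs (t - s) <= 1).
    { split; [apply Rabs_pos | apply Rabs_le; lra]. }
    assert (0 < diagonal d1 d2 (t - 1 / 2)) by (apply H; lra).
    assert (0 <= Rabs (t - s) * (1 - Rabs (t - s)) / 2) by nra.
    nra.
Qed.

Lemma Rabs_lt_half_sqrt (a b : R) : Rabs a < / 2 * sqrt b <-> 4 * a ^ 2 < b.
Proof.
  assert (E : sqrt (4 * a ^ 2) = 2 * Rabs a).
  { replace (4 * a ^ 2) with (Rsqr (2 * a)) by (unfold Rsqr; ring).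
    rewrite sqrt_Rsqr_abs, Rabs_mult, (Rabs_pos_eq 2); lra. }
  split; intros H.
  - apply sqrt_lt_0_alt. rewrite E. lra.
  - assert (sqrt (4 * a ^ 2) < sqrt b) by (apply sqrt_lt_1_alt; nra). lra.
Qed.

(** For [d2 < -4] the end points give [|d1| < 2 < - d2 / 2], so the vertex is
    interior, and the minimum there is positive exactly under the discriminant
    bound.  For [d2 >= -4] the worst case is [d2 = -4], where the quadratic is
    bounded below by a square. *)
Lemma diagonal_pos_iff (d1 d2 : R) :
  -8 < d2 < 0 ->
  (forall x, - (1 / 2) <= x <= 1 / 2 -> 0 < diagonal d1 d2 x) <->
  Rabs d1 < (if Rlt_dec d2 (-4)
             then / 2 * sqrt (- 8 * d2 - d2 ^ 2)
             else 2).
Proof.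
  intros Hd. unfold diagonal. split.
  - intros H.
    assert (Hl := H (- (1 / 2)) ltac:(lra)).
    assert (Hr := H (1 / 2) ltac:(lra)).
    destruct (Rlt_dec d2 (-4)) as [Hd4|Hd4]; [|apply Rabs_def1; lra].
    apply Rabs_lt_half_sqrt.
    (* [- d1 / d2] is the vertex. *)
    assert (Hv : - (1 / 2) <= - d1 / d2 <= 1 / 2).
    { assert (E : - d1 / d2 * d2 = - d1) by (field; lra). nra. }
    apply H in Hv.
    replace (1 - d1 * (- d1 / d2) + d2 / 8 - d2 * (- d1 / d2) ^ 2 / 2)
      with ((8 * d2 + d2 ^ 2 + 4 * d1 ^ 2) / (8 * d2)) in Hv by (field; lra).
    assert (E : (8 * d2 + d2 ^ 2 + 4 * d1 ^ 2) / (8 * d2) * (8 * d2)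
                = 8 * d2 + d2 ^ 2 + 4 * d1 ^ 2) by (field; lra).
    nra.
  - intros H x Hx.
    destruct (Rlt_dec d2 (-4)) as [Hd4|Hd4].
    + apply Rabs_lt_half_sqrt in H.
      (* completing the square *)
      assert (E : - 2 * d2 * (1 - d1 * x + d2 / 8 - d2 * x ^ 2 / 2)
        = (d2 * x + d1) ^ 2 + (- 8 * d2 - d2 ^ 2 - 4 * d1 ^ 2) / 4) by field.
      assert (0 <= (d2 * x + d1) ^ 2) by apply pow2_ge_0.
      nra.
    + apply Rabs_def2 in H.
      assert (0 <= (d2 + 4) * (1 - 4 * x ^ 2)) by (apply Rmult_le_pos; nra).
      (* The bound on [d1 * x] is strict only away from [x = 0]. *)
      destruct (Rtotal_order x 0) as [Hx0|[Hx0|Hx0]].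
      * assert (0 <= (x + 1 / 2) ^ 2) by apply pow2_ge_0. nra.
      * subst x. lra.
      * assert (0 <= (x - 1 / 2) ^ 2) by apply pow2_ge_0. nra.
Qed.

Theorem theorem5p8 (delta1 delta2 : R) (G : R -> R -> R)
  (Hdelta2 : -8 < delta2 < 0)
  (HG : is_green_function 0 delta1 delta2 G) :
  (forall t s : R, 0 <= t <= 1 -> 0 <= s <= 1 -> 0 < G t s) <->
  Rabs delta1 < (if Rlt_dec delta2 (-4)
                 then / 2 * sqrt (- 8 * delta2 - delta2 ^ 2)
                 else 2).
Proof.
  assert (HK : forall t s, unit_interval t -> unit_interval s ->
                 G t s = green_kernel delta1 delta2 t s)
    by (apply green_function_unique; [lra | exact HG]).
  rewrite <- (diagonal_pos_iff delta1 delta2 Hdelta2).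
  rewrite <- green_kernel_pos_iff by lra.
  split; intros H t s Ht Hs.
  - rewrite <- HK by assumption. now apply H.
  - rewrite HK by assumption. now apply H.
Qed.
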